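(* Let $\Sigma$ be a signed graph. Write $X_\Sigma$ as a polynomial with rational coefficients in the elements of $\{\xi_n : n\ge 1\}\cup\{q_{a,b}: a,b\ge 1\}\cup\{z\}$. Then for every $k\ge0$, the number of acyclic orientations of $\Sigma$ with exactly $k$ sinks equals the sum of the coefficients of those monomials for which the sum of the indices $n$ of its $\xi_n$ factors (counted with multiplicity) equals $k$.
   Context: A signed graph $\Sigma$ is a finite graph (loops and multiple edges allowed) together with a sign function $\mathrm{sgn}:E(\Sigma)\to\{+,-\}$; write $e:uv$ if $e$ has endpoints $u,v$ ($u=v$ for a loop). A coloring is a map $\kappa:V(\Sigma)\to\mathbb{Z}$; it is proper if $\kappa(u)\neq \mathrm{sgn}(e)\kappa(v)$ for every edge $e:uv$. The chromatic $B$-symmetric function is $X_\Sigma=\sum_{\kappa\text{ proper}}\prod_{v\in V(\Sigma)}x_{\kappa(v)}$, a formal power series in commuting variables $x_i$, $i\in\mathbb{Z}$. An orientation of $\Sigma$ assigns to each incidence of an edge with an endpoint (each half-edge; a loop has two) an arrow pointing toward or away from that vertex, such that on a positive edge exactly one of the two arrows points toward its vertex, and on a negative edge the two arrows either both point toward their vertices or both point away. A cycle is a closed walk such that, considering only the edges of the walk, every vertex of the walk has at least one arrow pointing into it and at least one pointing out of it; an orientation is acyclic if it has no cycle. A sink is a vertex all of whose incident arrows point toward it (an isolated vertex is a sink). Notation: $p_{a,b}=\sum_{i\in\mathbb{Z}}x_i^a x_{-i}^b$; $q_{a,b}=(-1)^{a+b+1}p_{a,b}$; $z=-x_0$; $\xi_n=\sum_{a=1}^n\binom{n}{a}p_{a,0}$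 for $n\ge1$ (equivalently $p_{n,0}=\sum_{i=1}^n\binom{n}{i}(-1)^{n-i}\xi_i$). *)

(* Defs.v *)
From HB Require Import structures.
From mathcomp Require Import all_boot all_order all_algebra.
From mathcomp Require Import mpoly.
From Stdlib Require Import ClassicalEpsilon.

Set Implicit Arguments.
Unset Strict Implicit.
Unset Printing Implicit Defensive.

Import Order.TTheory GRing.Theory Num.Theory.
Local Open Scope ring_scope.

(* Signed graphs.  A signed graph is given by a finite vertex type V,  *)
(* a finite edge type E (multiple edges allowed), an endpoint map       *)
(* ends : E -> V * V (a loop has ends e = (v, v)) and a sign map        *)
(* pos : E -> bool (pos e = true iff sgn e = +).                        *)

(* Half-edges: (e, false) is the incidence of e with (ends e).1,
   (e, true) the incidence with (ends e).2. A loop has two half-edges. *)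
Definition hend (V E : finType) (ends : E -> V * V) (h : E * bool) : V :=
  if h.2 then (ends h.1).2 else (ends h.1).1.

(* An orientation assigns to each half-edge an arrow; tau h = true means
   the arrow points toward the vertex hend h. *)
Definition is_orientation (E : finType) (pos : E -> bool)
    (tau : {ffun E * bool -> bool}) : bool :=
  [forall e : E, if pos e then tau (e, false) != tau (e, true)
                 else tau (e, false) == tau (e, true)].

Definition joins (V E : finType) (ends : E -> V * V) (e : E) (u w : V) : bool :=
  (ends e == (u, w)) || (ends e == (w, u)).

Fixpoint walk_to (V E : finType) (ends : E -> V * V)
    (u : V) (s : seq (E * V)) (v0 : V) : bool :=
  match s with
  | [::] => u == v0
  | (e, w) :: s' => joins ends e u w && walk_to ends w s' v0
  end.

Definition is_cycle (V E : finType) (ends : E -> V * V)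
    (tau : {ffun E * bool -> bool}) (v0 : V) (s : seq (E * V)) : Prop :=
  walk_to ends v0 s v0 /\
  forall v, v \in v0 :: map snd s ->
    (exists h : E * bool, [/\ h.1 \in map fst s, hend ends h = v & tau h]) /\
    (exists h : E * bool, [/\ h.1 \in map fst s, hend ends h = v & ~~ tau h]).

Definition acyclic (V E : finType) (ends : E -> V * V)
    (tau : {ffun E * bool -> bool}) : Prop :=
  forall (v0 : V) (s : seq (E * V)), ~ is_cycle ends tau v0 s.

Definition decb (P : Prop) : bool :=
  if excluded_middle_informative P then true else false.

(* v is a sink: all incident arrows point toward v (isolated => sink) *)
Definition is_sink (V E : finType) (ends : E -> V * V)
    (tau : {ffun E * bool -> bool}) (v : V) : bool :=
  [forall h : E * bool, (hend ends h == v) ==> tau h].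

Definition num_acyclic_sinks (V E : finType) (ends : E -> V * V)
    (pos : E -> bool) (k : nat) : nat :=
  #|[set tau : {ffun E * bool -> bool} |
      [&& is_orientation pos tau, decb (acyclic ends tau)
        & #|[set v | is_sink ends tau v]| == k]]|.

(* Formal power series in x_i (i in Z) are handled through their        *)
(* truncations: for each N, set x_i = 0 for |i| > N.  The truncation   *)
(* lives in {mpoly rat[2N+1]}, the variable 'X_j (j : 'I_(2N+1))        *)
(* standing for x_(j - N).  Two series of bounded degree are equal iff  *)
(* all their truncations are equal, and truncation is a ring morphism.  *)

Notation TP N := {mpoly rat[N.*2.+1]}.

Definition toZ (N : nat) (j : 'I_(N.*2.+1)) : int := (j%:Z - N%:Z)%R.

Definition proper (V E : finType) (ends : E -> V * V) (pos : E -> bool)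
    (N : nat) (kappa : {ffun V -> 'I_(N.*2.+1)}) : bool :=
  [forall e : E,
     toZ (kappa (ends e).1) !=
       (if pos e then 1 else -1) * toZ (kappa (ends e).2)].

Definition XSigma (V E : finType) (ends : E -> V * V) (pos : E -> bool)
    (N : nat) : TP N :=
  \sum_(kappa : {ffun V -> 'I_(N.*2.+1)} | proper ends pos kappa)
     \prod_(v : V) 'X_(kappa v).

(* truncation of p_{a,b} = sum_i x_i^a x_{-i}^b ; rev_ord j represents
   the integer -(j - N). *)
Definition pab (N a b : nat) : TP N :=
  \sum_(j : 'I_(N.*2.+1)) 'X_j ^+ a * 'X_(rev_ord j) ^+ b.

Definition qab (N a b : nat) : TP N := (-1) ^+ (a + b + 1) * pab N a b.

Definition xin (N n : nat) : TP N :=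
  \sum_(1 <= a < n.+1) ('C(n, a))%:R * pab N a 0.

(* z = - x_0 ; x_0 is 'X_(inord N) *)
Definition zz (N : nat) : TP N := - 'X_(inord N).

(* Polynomials with rational coefficients in the generators xi_n (n>=1), *)
(* q_{a,b} (a,b>=1) and z, written as finite formal sums of terms        *)
(* (coefficient, monomial), a monomial being a list (multiset) of        *)
(* generators.                                                           *)

Inductive gen := Xi of nat | Qg of nat & nat | Zg.

Definition valid_gen (g : gen) : bool :=
  match g with
  | Xi n => 0 < n
  | Qg a b => (0 < a) && (0 < b)
  | Zg => true
  end%N.

Definition genpoly := seq (rat * seq gen).

Definition valid_poly (P : genpoly) : bool :=
  all (fun t => all valid_gen t.2) P.

Definition geval (N : nat) (g : gen) : TP N :=
  match g with
  | Xi n => xin N n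
  | Qg a b => qab N a b
  | Zg => zz N
  end.

Definition peval (N : nat) (P : genpoly) : TP N :=
  \sum_(t <- P) t.1 *: \prod_(g <- t.2) geval N g.

Definition xi_weight (m : seq gen) : nat :=
  sumn [seq (match g with Xi n => n | _ => 0%N end) | g <- m].

Definition xi_coef_sum (P : genpoly) (k : nat) : rat :=
  \sum_(t <- P | xi_weight t.2 == k) t.1.

(* Main.v *)
(* The map xi_n |-> t^n, q_{a,b} |-> 1, z |-> 1 turns the sum over weights into
   a polynomial in t.  It is a specialization of the variables: x_0 = -1, one
   pair (x_i, x_{-i}) equal to (t - 1, 0), and m pairs equal to (-1, -1), where
   everything is polynomial in m and m is finally set to -1.  Sorting the proper
   colorings by the set S of vertices with the color of the first pair, X_Sigma
   becomes the sum of (t - 1)^|S| (-1)^|V - S| chi_{Sigma - S}(2m + 1) over the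
   sets S spanning no positive edge.  At m = -1 Zaslavsky's reciprocity replaces
   (-1)^|V - S| chi_{Sigma - S}(-1) by the number of acyclic orientations of
   Sigma - S, that is of those of Sigma in which all vertices of S are sinks;
   summing over S gives the sum of t^(number of sinks).  Reciprocity itself comes
   from the recursion that removes the vertices of the two extreme colors: it
   continues to m = -1 because the vertices colored +top and -top correspond to
   prescribed sinks and sources. *)
Require Import Defs.
From HB Require Import structures.
From mathcomp Require Import all_boot all_order all_algebra.
From mathcomp Require Import mpoly.
From mathcomp Require Import ring zify.

Set Implicit Arguments.
Unset Strict Implicit.
Unset Printing Implicit Defensive.

Import Order.TTheory GRing.Theory Num.Theory.
Local Open Scope ring_scope.

(** * Orientations with prescribed sinks and sources *)

Section PartialSignings.
Variables (V E : finType) (ends : E -> V * V) (pos : E -> bool).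
Implicit Types (W : {set V}) (e : E) (h : E * bool) (s : {ffun V -> option bool}).

Definition edges_in W : {set E} :=
  [set e | ((ends e).1 \in W) && ((ends e).2 \in W)].

(** A partial signing [s] marks a vertex by [Some true] (prescribed sink, or color [c]) or by
    [Some false] (prescribed source, or color [neg c]). *)
Definition dom s : {set V} := [set v | isSome (s v)].

(** One condition serves twice: a positive edge joins neither equally oriented nor equally colored
    marked vertices, and a negative edge joins no opposite ones. *)
Definition admissible s : bool :=
  [forall e, match s (ends e).1, s (ends e).2 with
             | Some a, Some b => a (+) b == pos e
             | _, _ => true
             end].

Lemma in_dom s v : (v \in dom s) = isSome (s v).
Proof. by rewrite inE. Qed.

Lemma hend_in_edges W h : h.1 \in edges_in W -> hend ends h \in W.
Proof. by rewrite inE /hend => /andP[]; case: h.2. Qed.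

Lemma edges_inS W1 W2 : W1 \subset W2 -> edges_in W1 \subset edges_in W2.
Proof.
move=> /subsetP sW; apply/subsetP=> e; rewrite !inE => /andP[/sW-> /sW->] //.
Qed.

Lemma edges_inD W s e :
  (e \in edges_in (W :\: dom s)) =
  [&& e \in edges_in W, ~~ s (ends e).1 & ~~ s (ends e).2].
Proof. by rewrite !inE; do 2!case: (isSome _); rewrite ?andbF ?andbT. Qed.

Definition extremal (a : E * bool -> bool) (F : {set E}) (v : V) : bool :=
  [exists h, (h.1 \in F) && (hend ends h == v)] &&
  [exists b, [forall h, (h.1 \in F) && (hend ends h == v) ==> (a h == b)]].

(** Acyclicity without walks: a cycle amounts to a nonempty edge set none of whose vertices has all
    its arrows in one direction. *)
Definition acyclic_on (a : E * bool -> bool) (F0 : {set E}) : bool :=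
  [forall F : {set E},
    (F \subset F0) && (F != set0) ==> [exists v, extremal a F v]].

(* An orientation is determined by its arrows at the first ends of the edges. *)
Definition arrow (o : {ffun E -> bool}) h : bool :=
  if h.2 then o h.1 (+) pos h.1 else o h.1.

(** The value [false] off [edges_in W] makes each orientation of the induced subgraph count once. *)
Definition acyclic_orientations W : {set {ffun E -> bool}} :=
  [set o : {ffun E -> bool} | [forall e, (e \notin edges_in W) ==> ~~ o e]
           && acyclic_on (arrow o) (edges_in W)].

Definition compatible (o : {ffun E -> bool}) W s : bool :=
  [forall h, (h.1 \in edges_in W) ==>
     (if s (hend ends h) is Some b then arrow o h == b else true)].

(** Arrows at marked vertices are forced; a mark [b] at the second end forces [b (+) pos e] at the
    first. The last [false] is never reached, as an edge in that branch has a marked end. *)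
Definition extend_orientation W s (o : {ffun E -> bool}) : {ffun E -> bool} :=
  [ffun e => if e \in edges_in (W :\: dom s) then o e
             else if e \notin edges_in W then false
             else match s (ends e).1, s (ends e).2 with
                  | Some a, _ => a
                  | None, Some b => b (+) pos e
                  | None, None => false
                  end].

Lemma arrow_extend_in W s o h :
  h.1 \in edges_in (W :\: dom s) -> arrow (extend_orientation W s o) h = arrow o h.
Proof. by move=> hW; rewrite /arrow ffunE hW. Qed.

Lemma arrow_extend_dom W s o h b :
  admissible s -> h.1 \in edges_in W -> s (hend ends h) = Some b ->
  arrow (extend_orientation W s o) h = b.
Proof.
move=> /forallP/(_ h.1) + hW; rewrite /arrow /hend ffunE edges_inD hW /=.
case: h.2 => /= + sh; rewrite sh /= ?andbF /=; last by [].
by case: (s (ends h.1).1) => [a /eqP<-|_]; rewrite ?addbK // addKb.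
Qed.

Lemma acyclic_on_eq (a a' : E * bool -> bool) (F0 : {set E}) :
  (forall h, h.1 \in F0 -> a h = a' h) -> acyclic_on a F0 = acyclic_on a' F0.
Proof.
move=> eqa; apply: eq_forallb => F; case: (boolP (F \subset F0)) => //= /subsetP sF.
congr (_ ==> _); apply: eq_existsb => v; congr (_ && _).
apply: eq_existsb => b; apply: eq_forallb => h.
by case: (boolP (h.1 \in F)) => //= /sF/eqa->.
Qed.

Lemma acyclic_onS a (F1 F2 : {set E}) :
  F1 \subset F2 -> acyclic_on a F2 -> acyclic_on a F1.
Proof.
move=> sF /forallP acF; apply/forallP=> F; apply/implyP=> /andP[sF1 F0].
by move/implyP: (acF F); apply; rewrite (subset_trans sF1).
Qed.

(** An edge of [F] outside [edges_in (W :\: dom s)] has a marked end, and all arrows there agree. *)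
Lemma compatible_dom_edges o W s (F : {set E}) :
  compatible o W s -> F \subset edges_in W ->
  ~~ (F \subset edges_in (W :\: dom s)) -> [exists v, extremal (arrow o) F v].
Proof.
move=> cs sF /subsetPn[e eF]; rewrite edges_inD (subsetP sF _ eF) /=.
have P h : h.1 \in F -> s (hend ends h) -> [exists v, extremal (arrow o) F v].
  move=> hF sh; apply/existsP; exists (hend ends h); apply/andP; split.
    by apply/existsP; exists h; rewrite hF eqxx.
  case shE: (s (hend ends h)) sh => [b|] // _.
  apply/existsP; exists b; apply/forallP=> h'; apply/implyP=> /andP[h'F /eqP hh].
  move/forallP: cs => /(_ h'); rewrite hh shE.
  by rewrite (subsetP sF _ h'F).
by rewrite negb_and !negbK => /orP[] sh; [apply: (P (e, false))|apply: (P (e, true))].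
Qed.

(* The sinks and sources prescribed by s lie on no cycle, so only the edges
   avoiding them carry a free choice. *)
Lemma card_compatible W s : dom s \subset W ->
  #|[set o in acyclic_orientations W | compatible o W s]| =
  (admissible s * #|acyclic_orientations (W :\: dom s)|)%N.
Proof.
move=> sW; case: (boolP (admissible s)) => adm; last first.
  rewrite mul0n; apply/eqP; rewrite cards_eq0; apply/set0Pn=> -[o].
  rewrite inE => /andP[_ cs]; case/negP: adm; apply/forallP=> e.
  have P b v : s v = Some b -> v \in W.
    by move=> sv; apply: (subsetP sW); rewrite in_dom sv.
  case s1: (s (ends e).1) => [a|] //; case s2: (s (ends e).2) => [b|] //.
  have eW : e \in edges_in W by rewrite inE (P _ _ s1) (P _ _ s2).
  move/forallP: (cs) => /(_ (e, false)); rewrite /hend /arrow /= eW s1 => /eqP<-.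
  move/forallP: (cs) => /(_ (e, true)); rewrite /hend /arrow /= eW s2 => /eqP<-.
  by rewrite addKb.
rewrite mul1n.
have sE : edges_in (W :\: dom s) \subset edges_in W by rewrite edges_inS ?subsetDl.
(* Forcing the arrows at marked vertices is a bijection from the orientations of the remaining graph
   onto the compatible ones. *)
rewrite -(@card_in_imset _ _ (extend_orientation W s)
           (mem (acyclic_orientations (W :\: dom s)))); last first.
  move=> o1 o2; rewrite !inE => /andP[/forallP so1 _] /andP[/forallP so2 _] eqo.
  apply/ffunP=> e; case: (boolP (e \in edges_in (W :\: dom s))) => eW.
    by move/ffunP: eqo => /(_ e); rewrite !ffunE eW.
  have:= so1 e; have:= so2 e; rewrite eW.
  by do 2![move=> /negbTE->].
apply: eq_card => o; apply/idP/imsetP; last first.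
  case=> o'; rewrite !inE => /andP[/forallP so' aco'] ->.
  have cmp : compatible (extend_orientation W s o') W s.
    apply/forallP=> h; apply/implyP=> hW; case sh: (s _) => [b|] //.
    by rewrite (arrow_extend_dom o' adm hW sh).
  rewrite cmp andbT; apply/andP; split.
    apply/forallP=> e; apply/implyP=> eW; rewrite ffunE eW.
    by case: ifP => // eW'; rewrite (subsetP sE _ eW') in eW.
  apply/forallP=> F; apply/implyP=> /andP[sF F0].
  case: (boolP (F \subset edges_in (W :\: dom s))) => sF'; last first.
    exact: compatible_dom_edges sF'.
  move/forallP: (etrans (acyclic_on_eq (@arrow_extend_in W s o')) aco') => /(_ F).
  by rewrite sF' F0.
rewrite inE [o \in acyclic_orientations _]inE => /andP[/andP[/forallP so aco] cs].
pose o' : {ffun E -> bool} := [ffun e => (e \in edges_in (W :\: dom s)) && o e].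
exists o'.
  rewrite !inE; apply/andP; split.
    by apply/forallP=> e; apply/implyP=> /negbTE eW; rewrite ffunE eW.
  rewrite (@acyclic_on_eq _ (arrow o)); first exact: acyclic_onS aco.
  by move=> h hW; rewrite /arrow ffunE hW.
apply/ffunP=> e; rewrite !ffunE.
case: (boolP (e \in edges_in (W :\: dom s))) => //= eW'.
case: (boolP (e \in edges_in W)) => //= eW; last first.
  by have := so e; rewrite eW => /negbTE->.
case s1: (s (ends e).1) => [a|].
  by move/forallP: (cs) => /(_ (e, false)); rewrite /hend /arrow /= eW s1 => /eqP<-.
case s2: (s (ends e).2) => [a|].
  move/forallP: (cs) => /(_ (e, true)); rewrite /hend /arrow /= eW s2 => /eqP<-.
  by rewrite addbK.
by move: eW'; rewrite edges_inD eW s1 s2.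
Qed.

(** * Colorings sorted by the vertices of two opposite colors *)

Section Colorings.
Variables (C : finType) (neg : C -> C) (c0 : C).
Implicit Types (D : {set C}) (kappa : {ffun V -> C}).

(** The default [c0] outside [W] makes each coloring of the induced subgraph count once. *)
Definition colorings W D : {set {ffun V -> C}} :=
  [set kappa : {ffun V -> C} | [forall v, if v \in W then kappa v \in D else kappa v == c0]
    && [forall e, (e \in edges_in W) ==>
         (kappa (ends e).1 != if pos e then kappa (ends e).2 else neg (kappa (ends e).2))]].

Definition pattern (c : C) kappa : {ffun V -> option bool} :=
  [ffun v => if kappa v == c then Some true
             else if kappa v == neg c then Some false else None].

Definition extend_coloring (c : C) s kappa : {ffun V -> C} :=
  [ffun v => if s v is Some b then if b then c else neg c else kappa v].

(** Removing the vertices colored [c] or [neg c] leaves a coloring with [D]. An edge from a removed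
    to a remaining vertex imposes nothing, as [D] is closed under [neg] and avoids [c]; edges
    between removed vertices impose [admissible s]. *)
Lemma card_pattern W D c s :
    involutive neg -> c0 \in D -> (forall d, d \in D -> neg d \in D) ->
    c \notin D -> neg c != c -> dom s \subset W ->
  #|[set kappa in colorings W (c |: (neg c |: D)) | pattern c kappa == s]| =
  (admissible s * #|colorings (W :\: dom s) D|)%N.
Proof.
move=> negK c0D negD cD ncc sW.
have ncD : neg c \notin D by apply: contra cD => /negD; rewrite negK.
have cN d : d \in D -> (d == c = false) * (d == neg c = false).
  by move=> dD; split; apply: contraTF dD => /eqP->.
have P b v : s v = Some b -> v \in W.
  by move=> sv; apply: (subsetP sW); rewrite in_dom sv.
case: (boolP (admissible s)) => adm; last first.
  rewrite mul0n; apply/eqP; rewrite cards_eq0; apply/set0Pn=> -[kappa].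
  rewrite inE [kappa \in _]inE => /andP[/andP[_ /forallP prop] /eqP ks].
  case/negP: adm; apply/forallP=> e.
  have Q v b : s v = Some b -> kappa v = if b then c else neg c.
    rewrite -ks ffunE; case: eqP => [->|_]; first by case=> <-.
    by case: eqP => [->|_] // [<-].
  case s1: (s (ends e).1) => [a|] //; case s2: (s (ends e).2) => [b|] //.
  have:= prop e; rewrite inE (P _ _ s1) (P _ _ s2) (Q _ _ s1) (Q _ _ s2) /=.
  by case: a {s1}; case: b {s2}; case: (pos e); rewrite ?negK ?eqxx.
rewrite mul1n -(@card_in_imset _ _ (extend_coloring c s)
           (mem (colorings (W :\: dom s) D))); last first.
  move=> k1 k2; rewrite !inE => /andP[/forallP sk1 _] /andP[/forallP sk2 _] eqk.
  apply/ffunP=> v; case sv: (s v) => [b|].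
    have:= sk1 v; have:= sk2 v; rewrite !inE sv /=.
    by do 2![move/eqP->].
  by move/ffunP: eqk => /(_ v); rewrite !ffunE sv.
apply: eq_card => k; apply/idP/imsetP; last first.
  case=> k'; rewrite !inE => /andP[/forallP vk' /forallP pk'] ->.
  have k'D v : k' v \in D.
    by have:= vk' v; case: ifP => // _ /eqP->.
  apply/andP; split; last first.
    apply/eqP/ffunP=> v; rewrite !ffunE.
    case sv: (s v) => [[]|]; rewrite ?eqxx ?(negbTE ncc) //.
    by rewrite !cN.
  apply/andP; split.
    apply/forallP=> v; rewrite ffunE; case sv: (s v) => [b|].
      by rewrite (P _ _ sv) !inE; case: b {sv}; rewrite eqxx ?orbT.
    by have:= vk' v; rewrite !inE sv /=; case: ifP => // _ ->; rewrite !orbT.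
  apply/forallP=> e; apply/implyP=> eW; have:= pk' e; rewrite edges_inD eW !ffunE.
  move/forallP: adm => /(_ e).
  case s1: (s (ends e).1) => [a|]; case s2: (s (ends e).2) => [b|] /=.
  - move=> + _; case: a {s1}; case: b {s2}; case: (pos e) => //= _; rewrite ?negK //.
    by rewrite eq_sym.
    by rewrite eq_sym.
  - move=> _ _; apply/negP => /eqP H.
    have: (if a then c else neg c) \in D by rewrite H; case: (pos e); rewrite ?negD.
    by apply/negP; case: a {s1 H}.
  - move=> _ _; apply/negP => /eqP H.
    have := k'D (ends e).1; rewrite H; apply/negP.
    by case: (pos e); case: b {s2 H}; rewrite ?negK.
  - by move=> _ ->.
rewrite inE [k \in _]inE => /andP[/andP[/forallP vk /forallP pk] /eqP ks].
pose k' : {ffun V -> C} := [ffun v => if s v then c0 else k v].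
exists k'; last first.
  apply/ffunP=> v; rewrite !ffunE -ks ffunE.
  by case: eqP => [->|_] //; case: eqP => [->|_].
rewrite !inE; apply/andP; split.
  apply/forallP=> v; rewrite !inE ffunE; have:= vk v.
  case sv: (s v) => [b|] //=; case: ifP => // vW.
  by rewrite !inE orbA => /orP[]//; move: sv; rewrite -ks ffunE; do 2!case: eqP.
apply/forallP=> e; apply/implyP; rewrite edges_inD => /and3P[eW s1 s2].
by have:= pk e; rewrite eW !ffunE (negbTE s1) (negbTE s2).
Qed.

Lemma pattern_dom W D c kappa :
  c0 \in D -> c \notin D -> neg c \notin D -> kappa \in colorings W (c |: (neg c |: D)) ->
  dom (pattern c kappa) \subset W.
Proof.
move=> c0D cD ncD; rewrite inE => /andP[/forallP vk _]; apply/subsetP=> v.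
rewrite in_dom ffunE; have:= vk v; case: (v \in W) => // /eqP->.
by case: eqP => [E0|_]; [rewrite -E0 c0D in cD|case: eqP => // E0; rewrite -E0 c0D in ncD].
Qed.

End Colorings.
End PartialSignings.

(** * Closed walks and the two forms of acyclicity *)

Section Walks.
Variables (V E : finType) (ends : E -> V * V).
Implicit Types (u v w : V) (s : seq (E * V)) (h : E * bool).

Lemma walk_to_cat u v w s1 s2 :
  walk_to ends u s1 v -> walk_to ends v s2 w -> walk_to ends u (s1 ++ s2) w.
Proof.
elim: s1 u => [|[e x] s1 IH] u /=; first by move/eqP->.
by case/andP=> -> /IH wk /wk.
Qed.

Lemma walk_to_split u v w s :
  walk_to ends u s w -> v \in u :: map snd s ->
  exists s1 s2, [/\ s = s1 ++ s2, walk_to ends u s1 v & walk_to ends v s2 w].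
Proof.
elim: s u => [|[e x] s IH] u /=.
  by move=> /eqP<-; rewrite inE => /eqP->; exists [::], [::]; rewrite /= eqxx.
case/andP=> ju wk; rewrite inE => /orP[/eqP->|vs].
  by exists [::], ((e, x) :: s); rewrite /= eqxx ju.
have [s1 [s2 [-> wk1 wk2]]] := IH _ wk vs.
by exists ((e, x) :: s1), s2; rewrite /= ju.
Qed.

Lemma walk_hend u w s h :
  walk_to ends u s w -> h.1 \in map fst s -> hend ends h \in u :: map snd s.
Proof.
elim: s u => [|[e x] s IH] u //= /andP[ju wk]; rewrite in_cons => /orP[/eqP he|hs].
  rewrite /hend he !inE.
  by case/orP: ju => /eqP->; case: h.2; rewrite /= eqxx ?orbT.
by rewrite in_cons (IH _ wk hs) orbT.
Qed.

Lemma walk_vertex u v w s :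
  walk_to ends u s w -> v \in map snd s ->
  exists2 h, h.1 \in map fst s & hend ends h = v.
Proof.
elim: s u => [|[e x] s IH] u //= /andP[ju wk]; rewrite in_cons => /orP[/eqP->|vs].
  by case/orP: ju => /eqP je; [exists (e, true)|exists (e, false)];
    rewrite ?inE ?eqxx // /hend /= je.
by have [h hs <-] := IH _ wk vs; exists h => //; rewrite in_cons hs orbT.
Qed.

Lemma saturated_walk (F : {set E}) v0 :
  exists s, [/\ walk_to ends v0 s v0, {subset map fst s <= F} &
    forall h, h.1 \in F -> hend ends h \in v0 :: map snd s -> h.1 \in map fst s].
Proof.
suff ex n s : (#|F :\: [set e in map fst s]| <= n)%N -> walk_to ends v0 s v0 ->
    {subset map fst s <= F} ->
  exists s', [/\ walk_to ends v0 s' v0, {subset map fst s' <= F} &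
    forall h, h.1 \in F -> hend ends h \in v0 :: map snd s' -> h.1 \in map fst s'].
  by apply: (ex _ [::] (leqnn _)) => //=.
elim: n s => [|n IH] s.
  rewrite leqn0 cards_eq0 setD_eq0 => /subsetP Fs wk sF.
  by exists s; split=> // h /Fs; rewrite inE.
move=> ns wk sF.
case: (boolP [forall h, (h.1 \in F) && (hend ends h \in v0 :: map snd s)
                ==> (h.1 \in map fst s)]) => [/forallP sat|].
  by exists s; split=> // h hF hs; have := sat h; rewrite hF hs.
rewrite negb_forall => /existsP[h]; rewrite negb_imply => /andP[/andP[hF hs] hns].
have [s1 [s2 [sE wk1 wk2]]] := walk_to_split wk hs.
pose v := hend ends h; pose w := hend ends (h.1, ~~ h.2).
have jE : joins ends h.1 v w && joins ends h.1 w v.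
  rewrite /joins /v /w /hend /=; case: h.2 => /=; rewrite -!surjective_pairing eqxx;
  by rewrite ?orbT.
have memE e : (e \in map fst (s1 ++ [:: (h.1, w), (h.1, v) & s2])) =
              (e == h.1) || (e \in map fst s).
  by rewrite sE !map_cat !mem_cat /= !inE; case: (e == h.1); rewrite ?orbT.
apply: (IH (s1 ++ [:: (h.1, w), (h.1, v) & s2])).
- rewrite -ltnS; apply: leq_trans ns; apply: proper_card.
  apply/properP; split.
    by apply/subsetP=> e; rewrite !in_setD !in_set memE negb_or => /andP[/andP[_ ->]].
  by exists h.1; rewrite !in_setD !in_set ?memE ?eqxx ?hns ?hF.
- by apply: walk_to_cat wk1 _; case/andP: jE => /= -> ->.
- by move=> e; rewrite memE => /orP[/eqP->|/sF].
Qed.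

(** The edges of a cycle form a set without extremal vertex. Conversely, in a nonempty set without
    one, a saturated closed walk uses all edges of the set at its vertices, so it is a cycle. *)
Lemma acyclicP (tau : {ffun E * bool -> bool}) :
  acyclic ends tau <-> acyclic_on ends tau setT.
Proof.
split=> [ac|/forallP ac v0 s [wk cyc]]; last first.
  have /implyP := ac [set e in map fst s]; rewrite subsetT /=.
  case: (cyc v0 (mem_head _ _)) => -[h0 [h0s _ _]] _.
  have -> : [set e in map fst s] != set0.
    by apply/set0Pn; exists h0.1; rewrite inE.
  case/(_ isT)/existsP=> v /andP[/existsP[h /andP[hs /eqP hv]] /existsP[b /forallP vb]].
  move: hs; rewrite inE => /(walk_hend wk); rewrite hv => /cyc[[h1 [h1s h1v t1]] [h2 [h2s h2v t2]]].
  have := vb h1; rewrite inE h1s h1v eqxx t1 /= => /eqP bE.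
  by have := vb h2; rewrite inE h2s h2v eqxx -bE /= (negbTE t2).
apply/forallP=> F; apply/implyP=> /andP[_ /set0Pn[e eF]].
apply: contraT; rewrite negb_exists => /forallP nex.
have [s [wk sF sat]] := saturated_walk F (ends e).1.
exfalso; apply: (ac (ends e).1 s); split=> // v vs.
have inc : [exists h, (h.1 \in F) && (hend ends h == v)].
  move: vs; rewrite in_cons => /orP[/eqP->|/(walk_vertex wk)[h hs <-]]; apply/existsP.
    by exists (e, false); rewrite eF /hend eqxx.
  by exists h; rewrite eqxx sF.
have ex b : exists h, [/\ h.1 \in map fst s, hend ends h = v & tau h != b].
  have := nex v; rewrite /extremal inc negb_exists => /forallP/(_ b).
  rewrite negb_forall => /existsP[h]; rewrite negb_imply => /andP[/andP[hF /eqP hv] hb].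
  by exists h; split=> //; apply: sat; rewrite ?hv.
split; [have [h [hs hv ht]] := ex false|have [h [hs hv ht]] := ex true];
  by exists h; split=> //; case: (tau h) ht.
Qed.

End Walks.

Lemma decbP (P : Prop) : reflect P (decb P).
Proof.
by rewrite /decb; case: ClassicalEpsilon.excluded_middle_informative => H; constructor.
Qed.

(** * Signed sums over acyclic orientations *)

Section Counting.
Variables (V E : finType) (ends : E -> V * V) (pos : E -> bool).
Implicit Types (W : {set V}) (s : {ffun V -> option bool}) (o : {ffun E -> bool}).

(** A vertex without edges in [edges_in W] is constant for both values of [b]. *)
Definition constant_at o W v b : bool :=
  [forall h, (h.1 \in edges_in ends W) && (hend ends h == v) ==> (arrow pos o h == b)].

Lemma edges_inT : edges_in ends setT = setT.
Proof. by apply/setP=> e; rewrite !inE. Qed.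

Lemma num_acyclic_sinksE k :
  num_acyclic_sinks ends pos k =
  #|[set o in acyclic_orientations ends pos setT
       | #|[set v | constant_at o setT v true]| == k]|.
Proof.
pose f o : {ffun E * bool -> bool} := [ffun h => arrow pos o h].
rewrite /num_acyclic_sinks -(@card_in_imset _ _ f (mem [set o in _ | _])); last first.
  move=> o1 o2 _ _ /ffunP eqf; apply/ffunP=> e.
  by have := eqf (e, false); rewrite !ffunE.
have sinkE o v : is_sink ends (f o) v = constant_at o setT v true.
  apply: eq_forallb => h; rewrite ffunE edges_inT in_setT /=.
  by case: (arrow _ _ _).
have acE o : acyclic_on ends (f o) setT = acyclic_on ends (arrow pos o) setT.
  by apply: acyclic_on_eq => h _; rewrite ffunE.
apply: eq_card => tau; apply/idP/imsetP.
  rewrite inE => /and3P[/forallP ot /decbP/acyclicP act /eqP <-].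
  pose o := [ffun e => tau (e, false)].
  have tE : tau = f o.
    apply/ffunP=> -[e b]; rewrite ffunE /arrow /= ffunE.
    have := ot e; case: b; case: (pos e) => //.
      by do 2!case: (tau _).
    by move/eqP->; rewrite addbF.
  exists o => //; rewrite inE [o \in _]inE edges_inT -acE -tE act andbT.
  apply/andP; split; first by apply/forallP=> e; rewrite inE.
  by apply/eqP/eq_card => v; rewrite !inE tE sinkE.
case=> o; rewrite !inE edges_inT -acE => /andP[/andP[_ aco] /eqP<-] ->.
apply/and3P; split.
- apply/forallP=> e; rewrite !ffunE /arrow /=.
  by case: (pos e); case: (o e).
- by apply/decbP/acyclicP.
- by apply/eqP/eq_card => v; rewrite !inE sinkE.
Qed.

Lemma compatible_constant o W s :
  compatible ends pos o W s =
  [forall v, if s v is Some b then constant_at o W v b else true].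
Proof.
apply/forallP/forallP=> [cs v|cv h].
  case sv: (s v) => [b|] //; apply/forallP=> h; apply/implyP=> /andP[hW /eqP hv].
  by have := cs h; rewrite hW hv sv.
apply/implyP=> hW; have := cv (hend ends h); case: (s _) => // b /forallP/(_ h).
by rewrite hW eqxx.
Qed.

Lemma sum_option_bool (F : option bool -> rat) :
  \sum_x F x = F None + F (Some true) + F (Some false).
Proof.
rewrite (bigD1 None) //= (bigD1 (Some true)) //= (bigD1 (Some false)) //=.
by rewrite big1 ?addr0 ?addrA // => -[[]|].
Qed.

(** After exchanging the sums, compatibility with a fixed orientation is a condition on each vertex
    separately, so the sum over [s] factors over [W]. *)
Lemma sum_compatible (w : option bool -> rat) W :
  \sum_(s : {ffun V -> option bool} | dom s \subset W)
    (\prod_(v in W) w (s v)) *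
    ((admissible ends pos s)%:R * #|acyclic_orientations ends pos (W :\: dom s)|%:R)
  = \sum_(o in acyclic_orientations ends pos W) \prod_(v in W)
      (w None + (constant_at o W v true)%:R * w (Some true)
              + (constant_at o W v false)%:R * w (Some false)).
Proof.
have cE s : #|[set o in acyclic_orientations ends pos W | compatible ends pos o W s]|%:R
    = \sum_(o in acyclic_orientations ends pos W) (compatible ends pos o W s)%:R :> rat.
  rewrite -sum1_card natr_sum [RHS]big_mkcond [LHS]big_mkcond; apply: eq_bigr => o _.
  by rewrite inE; case: (_ \in _) => //=; case: compatible.
under eq_bigr => s sW do
  rewrite -natrM -(card_compatible ends pos sW) cE mulr_sumr.
rewrite exchange_big /=; apply: eq_bigr => o _.
pose ok v (x : option bool) : bool := if x is Some b then constant_at o W v b else true.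
pose F v x : rat := if v \in W then (ok v x)%:R * w x else 1.
transitivity (\prod_v \sum_(x | (v \in W) || (x == None)) F v x); last first.
  rewrite [RHS]big_mkcond /=; apply: eq_bigr => v _; rewrite /F; case: (v \in W) => /=.
    by rewrite sum_option_bool mul1r.
  by rewrite big_pred1_eq.
rewrite (bigA_distr_big_dep _ F); apply: eq_big => s.
  apply/subsetP/familyP => sW v; have := sW v; rewrite in_dom !unfold_in.
    by case: (s v) => [b|] /=; rewrite ?orbT // => ->.
  by case: (s v) => [b|] //=; rewrite orbF.
move=> /subsetP sW; rewrite compatible_constant; case: forallP => [cs|/forallP].
  rewrite mulr1 big_mkcond; apply: eq_bigr => v _; rewrite /F; case: (v \in W) => //.
  by have := cs v; rewrite /ok; case: (s v) => [b ->|_]; rewrite mul1r.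
rewrite negb_forall => /existsP[v]; case sv: (s v) => [b|] // /negbTE nc.
have vW : v \in W by apply: sW; rewrite in_dom sv.
by rewrite mulr0 (bigD1 v) //= /F vW sv /= nc !mul0r.
Qed.

Lemma prod_sign W s :
  \prod_(v in W) (if s v then 1 else -1) = (-1) ^+ #|W :\: dom s| :> rat.
Proof.
rewrite (bigID (mem (dom s))) /= big1 ?mul1r; last first.
  by move=> v; rewrite in_dom => /andP[_ ->].
rewrite (eq_bigr (fun=> -1)); last by move=> v; rewrite in_dom => /andP[_ /negbTE->].
by rewrite -prodr_const; apply: eq_bigl => v; rewrite !inE andbC.
Qed.

(* The chromatic polynomial with index shifted by one: [n.+1] stands for the
   palette {-n, ..., n} and [0] for its continuation to n = -1, whose value is
   the one given by reciprocity. *)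
Fixpoint chi n W : rat :=
  if n is n'.+1 then
    \sum_(s : {ffun V -> option bool} | dom s \subset W)
      (admissible ends pos s)%:R * chi n' (W :\: dom s)
  else (-1) ^+ #|W| * #|acyclic_orientations ends pos W|%:R.

(** The step of reciprocity from n = -1 to n = 0, where 0 is the only color. Each vertex contributes
    -1, plus 1 if it is a sink, plus 1 if it is a source. An extremal vertex with edges makes this
    0; without edges every factor is 1. *)
Lemma chi1 W : chi 1 W = (edges_in ends W == set0)%:R.
Proof.
(* Through the coercion [isSome], [w] is 1 on both marks. *)
pose w (x : option bool) : rat := if x then 1 else -1.
transitivity (\sum_(s : {ffun V -> option bool} | dom s \subset W)
    (\prod_(v in W) w (s v)) * ((admissible ends pos s)%:R *
      #|acyclic_orientations ends pos (W :\: dom s)|%:R)).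
  by apply: eq_bigr => s _; rewrite prod_sign /= mulrCA.
rewrite sum_compatible /w /=; case: eqP => [W0|/eqP W0].
  rewrite (big_pred1 [ffun=> false]) => [|o]; last first.
    rewrite !inE; apply/idP/eqP => [/andP[/forallP so _]|->].
      by apply/ffunP=> e; have := so e; rewrite W0 inE ffunE => /negbTE.
    rewrite W0; apply/andP; split; first by apply/forallP=> e; rewrite ffunE implybT.
    by apply/forallP=> F; rewrite subset0; case: eqP.
  rewrite big1 // => v _.
  have c b : constant_at [ffun=> false] W v b.
    by apply/forallP=> h; rewrite W0 inE.
  by rewrite !c.
rewrite big1 // => o; rewrite inE => /andP[_ /forallP/(_ (edges_in ends W))].
rewrite subxx W0 /= => /existsP[v /andP[/existsP[h /andP[hW /eqP hv]] /existsP[b cb]]].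
have vW : v \in W by rewrite -hv hend_in_edges.
have cE b' : constant_at o W v b' = (b' == b).
  apply/idP/eqP => [/forallP/(_ h)|->] //; rewrite hW hv eqxx /= => /eqP<-.
  by move/forallP: cb => /(_ h); rewrite hW hv eqxx /= => /eqP.
by rewrite (bigD1 v) //= !cE; case: b {cb cE} => /=; ring.
Qed.

End Counting.

(** * Polynomiality of [chi] in the palette size *)

Section ChiPolynomial.
Variables (V E : finType) (ends : E -> V * V) (pos : E -> bool).
Implicit Types (W : {set V}) (s : {ffun V -> option bool}).

(** The empty marking reproduces the value at n, so the difference of the values at n + 1 and n is a
    combination of values at n for proper subsets of [W]; induct on the size of [W]. *)
Lemma chi_newton K W : (#|W| < K)%N ->
  exists d : nat -> rat, forall n,
    chi ends pos n W = \sum_(j < K) d j * 'C(n, j)%:R.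
Proof.
elim: K W => // K IH W; rewrite ltnS => WK.
pose s0 : {ffun V -> option bool} := [ffun=> None].
have ds0 : dom s0 = set0 by apply/setP=> v; rewrite !inE ffunE.
pose Q s (d : nat -> rat) := (dom s \subset W) && (s != s0) -> forall n,
  chi ends pos n (W :\: dom s) = \sum_(j < K) d j * 'C(n, j)%:R.
have /(@fin_all_exists _ _ Q)[d dE] s : exists d, Q s d.
  case: (boolP ((dom s \subset W) && (s != s0))) => [|/negbTE ns]; last first.
    by exists (fun=> 0); rewrite /Q ns.
  case/andP=> sW ns; have [|d dP] := IH (W :\: dom s); last by exists d.
  apply: leq_trans WK; apply: proper_card; apply/properP; split; first exact: subsetDl.
  have /set0Pn[v vs] : dom s != set0.
    apply: contra ns => /eqP/setP s00; apply/eqP/ffunP=> v; rewrite ffunE.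
    by have := s00 v; rewrite !inE; case: (s v).
  by exists v; [apply: (subsetP sW)|rewrite !inE; move: vs; rewrite inE => ->].
pose D j := \sum_(s | (dom s \subset W) && (s != s0)) (admissible ends pos s)%:R * d s j.
(* The constant coefficient is the value at 0; the others are those of the difference, shifted by
   one, by Pascal's rule. *)
exists (fun j => if j is j'.+1 then D j' else chi ends pos 0 W) => n.
rewrite big_ord_recl bin0 mulr1 /=.
elim: n => [|n IHn]; first by rewrite big1 ?addr0 // => i _; rewrite bin0n mulr0.
rewrite [LHS]/= (bigD1 s0) ?ds0 ?sub0set //= setD0.
have -> : admissible ends pos s0 by apply/forallP=> e; rewrite ffunE.
rewrite mul1r IHn -addrA; congr (_ + _).
rewrite (eq_bigr (fun s => \sum_(j < K) (admissible ends pos s)%:R * (d s j * 'C(n, j)%:R)));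
  last by move=> s /dE/(_ n)->; rewrite mulr_sumr.
rewrite exchange_big -big_split /=; apply: eq_bigr => j _.
rewrite /bump /= add1n binS natrD mulrDr; congr (_ + _).
by rewrite mulr_suml; apply: eq_bigr => s _; rewrite mulrA.
Qed.

(** Built from (j + 1) C(n, j + 1) = (n - j) C(n, j). *)
Lemma bin_poly j : exists p : {poly rat}, forall n, p.[n%:R] = 'C(n, j)%:R.
Proof.
elim: j => [|j [p pE]]; first by exists 1 => n; rewrite hornerE bin0.
exists (j.+1%:R^-1 *: (p * ('X - j%:R%:P))) => n; rewrite hornerZ hornerM hornerXsubC pE.
apply: (mulfI (x := j.+1%:R)); first by rewrite pnatr_eq0.
rewrite mulVKf ?pnatr_eq0 // -natrM mul_bin_left.
have [nj|jn] := ltnP n j; first by rewrite bin_small // muln0 mul0r.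
by rewrite natrM natrB // mulrC.
Qed.

Lemma chi_poly W : exists p : {poly rat}, forall n, p.[n%:R] = chi ends pos n W.
Proof.
have [d dE] := chi_newton (ltnSn #|W|).
have [p pE] : exists p : 'I_#|W|.+1 -> {poly rat}, forall j n, (p j).[n%:R] = 'C(n, j)%:R.
  exact: (@fin_all_exists 'I_#|W|.+1 (fun=> {poly rat})
            (fun j p => forall n, p.[n%:R] = 'C(n, j)%:R)
            (fun j => bin_poly j)).
exists (\sum_(j < #|W|.+1) d j *: p j) => n; rewrite dE horner_sum.
by apply: eq_bigr => j _; rewrite hornerZ pE.
Qed.

End ChiPolynomial.

Lemma eq_big_all (R I : Type) (idx : R) (op : R -> R -> R) (a : pred I) (r : seq I)
    (F G : I -> R) :
  all a r -> (forall i, a i -> F i = G i) ->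
  \big[op/idx]_(i <- r) F i = \big[op/idx]_(i <- r) G i.
Proof.
move=> + FG; elim: r => [|i r IH] /=; first by rewrite !big_nil.
by case/andP=> /FG Fi /IH Fr; rewrite !big_cons Fi Fr.
Qed.

(** Infinitely many common values suffice. The point 0 is left out, since truncations give equality
    only at positive integers and the value at 0 is what is sought. *)
Lemma poly_eq_nat (p q : {poly rat}) :
  (forall n, p.[n.+1%:R] = q.[n.+1%:R]) -> p = q.
Proof.
move=> pq; apply/eqP; rewrite -subr_eq0; apply/eqP.
pose rs : seq rat := [seq i.+1%:R | i <- iota 0 (size (p - q))].
apply: (@roots_geq_poly_eq0 _ _ rs); last by rewrite size_map size_iota.
  by apply/allP=> _ /mapP[i _ ->]; rewrite rootE !hornerE pq subrr.
rewrite map_inj_uniq ?iota_uniq // => i j /eqP.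
by rewrite eqr_nat eqSS => /eqP.
Qed.

(** * Symmetric palettes and proper colorings *)

Section Palette.
Variables (V E : finType) (ends : E -> V * V) (pos : E -> bool).
Implicit Types (W : {set V}) (s : {ffun V -> option bool}).

(** Index [j] stands for the color [j - N], so this is {-n, ..., n}, and [rev_ord] negates
    colors. *)
Definition palette N n : {set 'I_N.*2.+1}  :=
  [set j : 'I_N.*2.+1 | (N - n <= j <= N + n)%N].

Definition top_color N n : 'I_N.*2.+1 := inord (N + n).

Lemma top_colorK N n : (n <= N)%N -> top_color N n = (N + n)%N :> nat.
Proof. by move=> nN; rewrite inordK //; lia. Qed.

Lemma rev_top_color N n : (n <= N)%N -> rev_ord (top_color N n) = (N - n)%N :> nat.
Proof. by move=> nN; rewrite /= top_colorK //; lia. Qed.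

Lemma paletteS N n : (n < N)%N ->
  palette N n.+1 = top_color N n.+1 |: (rev_ord (top_color N n.+1) |: palette N n).
Proof.
move=> nN; apply/setP=> j; rewrite !inE -!val_eqE [val (rev_ord _)]rev_top_color //.
by rewrite [val (top_color _ _)]top_colorK //=; have := ltn_ord j; lia.
Qed.

Lemma sum_pattern N n W (F : {ffun V -> option bool} -> rat) : (n < N)%N ->
  \sum_(kappa in colorings ends pos (@rev_ord _) (inord N) W (palette N n.+1))
     F (pattern (@rev_ord _) (top_color N n.+1) kappa) =
  \sum_(s : {ffun V -> option bool} | dom s \subset W)
     F s * ((admissible ends pos s)%:R *
       #|colorings ends pos (@rev_ord _) (inord N) (W :\: dom s) (palette N n)|%:R).
Proof.
move=> nN; set c := top_color N n.+1.
have c0 : inord N \in palette N n by rewrite inE inordK; lia.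
have cD : c \notin palette N n by rewrite inE top_colorK //; lia.
have ncD : rev_ord c \notin palette N n by rewrite inE rev_top_color //; lia.
have nc : rev_ord c != c by rewrite -val_eqE /= top_colorK //; lia.
have negD (d : 'I_N.*2.+1) : d \in palette N n -> rev_ord d \in palette N n.
  by rewrite !inE /=; have := ltn_ord d; lia.
rewrite (partition_big (pattern (@rev_ord _) c) (fun s => dom s \subset W)) /=; last first.
  by move=> kappa; rewrite paletteS //; apply: pattern_dom.
apply: eq_bigr => s sW.
rewrite -natrM -(@card_pattern _ _ ends pos _ (@rev_ord _) (inord N) W _ c) //; last first.
  exact: rev_ordK.
rewrite -paletteS // -sum1_card natr_sum mulr_sumr.
apply: eq_big => [kappa|kappa /andP[_ /eqP->]]; last by rewrite mulr1.
by rewrite [RHS]inE.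
Qed.

(** Removing the two extreme colors gives the recursion that defines [chi]; the base case, palette
    {0}, is [chi1]. *)
Lemma card_colorings_palette N n W : (n <= N)%N ->
  #|colorings ends pos (@rev_ord _) (inord N) W (palette N n)|%:R = chi ends pos n.+1 W.
Proof.
elim: n W => [|n IH] W nN.
  rewrite chi1; pose k0 : {ffun V -> 'I_N.*2.+1} := [ffun=> inord N].
  have jE (j : 'I_N.*2.+1) : (N - 0 <= j <= N + 0)%N -> j = inord N.
    by move=> jN; apply/val_inj; rewrite /= inordK; lia.
  have kE k : k \in colorings ends pos (@rev_ord _) (inord N) W (palette N 0) -> k = k0.
    rewrite inE => /andP[/forallP vk _]; apply/ffunP=> v; rewrite ffunE.
    have := vk v; case: ifP => [_|_ /eqP] //; rewrite inE; apply: jE.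
  (* The color 0 is its own negative, so an edge of either sign forbids it at both ends. *)
  have k0E e : (e \in edges_in ends W) ->
      k0 \notin colorings ends pos (@rev_ord _) (inord N) W (palette N 0).
    move=> eW; rewrite inE negb_and; apply/orP; right; rewrite negb_forall.
    apply/existsP; exists e; rewrite eW !ffunE negbK; case: (pos e) => //.
    by rewrite -val_eqE /= inordK; lia.
  have [W0|/set0Pn[e eW]] := eqVneq; last first.
    rewrite (_ : colorings _ _ _ _ _ _ = set0) ?cards0 //.
    apply/setP=> k; rewrite in_set0; apply/negP=> kc; move: (kc).
    by rewrite (kE _ kc) (negbTE (k0E _ eW)).
  rewrite (_ : colorings _ _ _ _ _ _ = [set k0]) ?cards1 //.
  apply/setP=> k; rewrite in_set1; apply/idP/eqP => [/kE|->] //.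
  rewrite inE W0; apply/andP; split; last by apply/forallP=> e; rewrite inE.
  by apply/forallP=> v; rewrite ffunE eqxx; case: ifP => // _; rewrite inE inordK; lia.
rewrite -sum1_card natr_sum (sum_pattern W (fun=> 1)) // [RHS]/=.
by apply: eq_bigr => s _; rewrite mul1r IH 1?ltnW.
Qed.

Lemma properE N (kappa : {ffun V -> 'I_N.*2.+1}) :
  Defs.proper ends pos kappa =
  (kappa \in colorings ends pos (@rev_ord _) (inord N) setT (palette N N)).
Proof.
rewrite inE; have -> /= : [forall v, if v \in setT then kappa v \in palette N N
                                     else kappa v == inord N].
  by apply/forallP=> v; rewrite !inE; have := ltn_ord (kappa v); lia.
apply: eq_forallb => e; rewrite !inE /= /toZ; congr (~~ _).
by case: (pos e); rewrite -val_eqE /=; have := ltn_ord (kappa (ends e).2);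
   have := ltn_ord (kappa (ends e).1); lia.
Qed.

End Palette.

(** * Specialization of the generators *)

Section Specialization.
Variables (t : rat) (m : nat).
Let N := m.+1.

(* In terms of the points (x_i, x_{-i}): one point (t - 1, 0), m points (-1, -1)
   and x_0 = -1; the value m = -1 realizes xi_n = t^n and q_{a,b} = z = 1. *)
Definition specialize (j : 'I_N.*2.+1) : rat :=
  if j == top_color N N then t - 1
  else if j == rev_ord (top_color N N) then 0 else -1.

(** Values of the generators under [specialize], as polynomials in N = m + 1; the 2m + 1 colors of
    value -1 enter as 2N - 1. Thus m = -1 is evaluation at 0. *)
Definition gen_poly (g : gen) : {poly rat} :=
  match g with
  | Xi n => (t ^+ n)%:P - 2%:R *: 'X
  | Qg _ _ => 1 - 2%:R *: 'X
  | Zg => 1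
  end.

Lemma rev_top_neq : rev_ord (top_color N N) != top_color N N.
Proof. by rewrite -val_eqE [val (rev_ord _)]rev_top_color // [val _]top_colorK //=; lia. Qed.

(** The top color contributes (t - 1)^a 0^b, its negative contributes 0 because a > 0, and each of
    the 2m + 1 others contributes (-1)^(a + b). *)
Lemma meval_pab a b : (0 < a)%N ->
  (pab N a b).@[specialize] = (b == 0)%:R * (t - 1) ^+ a + m.*2.+1%:R * (-1) ^+ (a + b).
Proof.
move=> a0; rewrite /pab rmorph_sum /=; set c := top_color N N.
under eq_bigr do rewrite mevalM !rmorphXn /= !mevalXU.
rewrite (bigD1 c) //= (bigD1 (rev_ord c)) ?rev_top_neq //=.
have sc : specialize c = t - 1 by rewrite /specialize eqxx.
have sr : specialize (rev_ord c) = 0 by rewrite /specialize (negbTE rev_top_neq) eqxx.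
rewrite rev_ordK sc sr expr0n mulrC; congr (_ + _).
rewrite [0 ^+ a]expr0n -[(a == 0)%N]negbK -lt0n a0 mul0r add0r.
rewrite (eq_bigr (fun=> (-1) ^+ (a + b))) => [|j /andP[jc jr]]; last first.
  rewrite /specialize -/c (negbTE jc) (negbTE jr) (inj_eq rev_ord_inj) (negbTE jc).
  by rewrite -(inj_eq rev_ord_inj) rev_ordK (negbTE jr) exprD.
rewrite sumr_const mulr_natl; congr (_ *+ _).
have := cardC (pred2 c (rev_ord c)); rewrite card2 eq_sym rev_top_neq card_ord.
rewrite (@eq_card _ (fun j => (j != c) && (j != rev_ord c)) (predC (pred2 c (rev_ord c)))).
  by move=> cE; apply: (@addnI 2).
by move=> j; rewrite !inE negb_or.
Qed.

Lemma binomial_sum n (y : rat) :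
  \sum_(1 <= a < n.+1) 'C(n, a)%:R * y ^+ a = (1 + y) ^+ n - 1.
Proof.
rewrite exprDn -(big_mkord xpredT (fun i => 1 ^+ (n - i) * y ^+ i *+ 'C(n, i))).
rewrite big_nat_recl // bin0 expr0 expr1n mulr1 mulr1n addrC addrA addNr add0r.
rewrite big_add1; apply: eq_bigr => i _.
by rewrite expr1n mul1r mulr_natl.
Qed.

(** For [Xi n] the binomial theorem at y = t - 1 and y = -1 gives (t^n - 1) - (2N - 1), as n > 0. *)
Lemma meval_geval g : valid_gen g ->
  (geval N g).@[specialize] = (gen_poly g).[N%:R].
Proof.
have E2 : m.*2.+1%:R = 2 * N%:R - 1 :> rat.
  by rewrite -addn1 -mul2n natrD natrM /N -[m.+1]addn1 natrD; ring.
case: g => [n|a b|] /= vg.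
- rewrite /xin rmorph_sum /=.
  under eq_big_nat => a /andP[a0 _] do
    rewrite rmorphM /= rmorph_nat meval_pab // addn0 mul1r mulrDr mulrCA.
  rewrite big_split /= -mulr_sumr !binomial_sum subrr expr0n [1 + _]addrC subrK.
  have -> : (n == 0)%N = false by lia.
  by rewrite !hornerE E2 /N; ring.
- case/andP: vg => a0 b0; rewrite /qab rmorphM rmorphXn rmorphN rmorph1 /= meval_pab //.
  have -> : (b == 0)%N = false by lia.
  rewrite mul0r add0r mulrCA -exprD (_ : (a + b + 1 + (a + b) = (a + b).*2.+1)%N); last by lia.
  by rewrite -signr_odd /= odd_double E2 !hornerE; ring.
- rewrite /zz rmorphN /= mevalXU hornerE /specialize -!val_eqE.
  rewrite [val (top_color _ _)]top_colorK // [val (rev_ord _)]rev_top_color //= inordK; last by lia.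
  case: eqP => [|_]; first by lia.
  by case: eqP => [|_]; [lia|rewrite opprK].
Qed.

End Specialization.

(** * The generating function of acyclic orientations by sinks *)

Section SinkEnumeration.
Variables (V E : finType) (ends : E -> V * V) (pos : E -> bool).

(** The product of values depends only on which vertices have the colors m + 1 and -(m + 1); the
    others are colored from {-m, ..., m}. *)
Lemma meval_XSigma t m :
  (XSigma ends pos m.+1).@[specialize t (m := m)] =
  \sum_(s : {ffun V -> option bool})
    (\prod_v (if s v is Some b then if b then t - 1 else 0 else -1)) *
    ((admissible ends pos s)%:R * chi ends pos m.+1 (setT :\: dom s)).
Proof.
rewrite /XSigma rmorph_sum /=.
under eq_bigl do rewrite properE.
under eq_bigr do rewrite rmorph_prod /=.
rewrite (eq_bigr (fun kappa : {ffun V -> _} => (fun s : {ffun V -> option bool} =>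
    \prod_v (if s v is Some b then if b then t - 1 else 0 else -1))
    (pattern (@rev_ord _) (top_color m.+1 m.+1) kappa))); last first.
  move=> kappa _; apply: eq_bigr => v _; rewrite mevalXU ffunE /specialize.
  by case: ifP => // _; case: ifP.
rewrite (sum_pattern ends pos setT (fun s : {ffun V -> option bool} =>
    \prod_v (if s v is Some b then if b then t - 1 else 0 else -1))) //.
apply: eq_big => s; first by rewrite subsetT.
by move=> _; rewrite card_colorings_palette.
Qed.

(** Both specialized expressions are polynomials in N that agree for N >= 1, hence at 0, where [chi]
    counts acyclic orientations up to sign. *)
Lemma sink_generating_function (Pg : genpoly) (t : rat) :
  valid_poly Pg -> (forall N, peval N Pg = XSigma ends pos N) ->
  \sum_(o in acyclic_orientations ends pos setT)
     t ^+ #|[set v | constant_at ends pos o setT v true]| =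
  \sum_(u <- Pg) u.1 * t ^+ xi_weight u.2.
Proof.
move=> vP PE.
have [p pE] : exists p : {set V} -> {poly rat}, forall W n, (p W).[n%:R] = chi ends pos n W.
  exact: (@fin_all_exists {set V} (fun=> {poly rat})
            (fun W p => forall n, p.[n%:R] = chi ends pos n W)
            (chi_poly ends pos)).
pose y (s : {ffun V -> option bool}) : rat :=
  \prod_v (if s v is Some b then if b then t - 1 else 0 else -1).
pose L := \sum_(s : {ffun V -> option bool})
   (y s * (admissible ends pos s)%:R) *: p (setT :\: dom s).
pose R := \sum_(u <- Pg) u.1 *: \prod_(g <- u.2) gen_poly t g.
have LR : L = R.
  apply: poly_eq_nat => m; rewrite !horner_sum.
  transitivity (XSigma ends pos m.+1).@[specialize t (m := m)].
    rewrite meval_XSigma; apply: eq_bigr => s _.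
    by rewrite hornerZ pE mulrA.
  rewrite -PE rmorph_sum; apply: eq_big_all vP _ => u uP.
  rewrite /= mevalZ hornerZ rmorph_prod horner_prod /=; congr (_ * _).
  exact: eq_big_all uP (@meval_geval t m).
have R0 : R.[0] = \sum_(u <- Pg) u.1 * t ^+ xi_weight u.2.
  rewrite horner_sum; apply: eq_bigr => u _; rewrite hornerZ horner_prod.
  congr (_ * _); rewrite /xi_weight; elim: (u.2) => [|g l IH]; first by rewrite big_nil.
  rewrite big_cons IH /= exprD; congr (_ * _).
  by case: g => [n|a b|]; rewrite !hornerE ?mulr0 ?subr0.
rewrite -R0 -LR horner_sum.
(* [w] drops the -1 that [y] has at each unmarked vertex; these signs cancel the sign in [chi] at
   0. *)
pose w (x : option bool) : rat := if x is Some b then if b then t - 1 else 0 else 1.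
transitivity (\sum_(s : {ffun V -> option bool} | dom s \subset [set: V])
    (\prod_(v in [set: V]) w (s v)) *
    ((admissible ends pos s)%:R *
     #|acyclic_orientations ends pos (setT :\: dom s)|%:R)).
  (* A sink contributes 1 + (t - 1) = t and any other vertex 1, as the source mark has weight 0. *)
  rewrite sum_compatible; apply: eq_bigr => o _; rewrite -prodr_const big_mkcond /=.
  rewrite [RHS](eq_bigl xpredT) => [|v]; last by rewrite inE.
  apply: eq_bigr => v _; rewrite inE /w; case: (constant_at _ _ _ _ _ true) => /=; ring.
apply: eq_big => s; first by rewrite subsetT.
move=> _; rewrite hornerZ -[0]/(0%:R) pE /= -prod_sign.
have T (F : V -> rat) : \prod_(v in [set: V]) F v = \prod_v F v.
  by apply: eq_bigl => v; rewrite inE.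
have -> : \prod_(v in [set: V]) w (s v) = y s * \prod_(v in [set: V]) (if s v then 1 else -1).
  rewrite !T -big_split; apply: eq_bigr => v _ /=.
  by rewrite /w; case: (s v) => [b|] /=; rewrite ?mulr1 // mulrNN mulr1.
ring.
Qed.

End SinkEnumeration.

Theorem theorem3p4 (V E : finType) (ends : E -> V * V) (pos : E -> bool)
    (Pg : genpoly) :
  valid_poly Pg ->
  (forall N : nat, peval N Pg = XSigma ends pos N) ->
  forall k : nat,
    ((num_acyclic_sinks ends pos k)%:R = xi_coef_sum Pg k :> rat)%R.
Proof.
move=> vP PE k.
pose sinks o := #|[set v | constant_at ends pos o setT v true]|.
pose P1 : {poly rat} := \sum_(o in acyclic_orientations ends pos setT) 'X^(sinks o).
pose P2 : {poly rat} := \sum_(u <- Pg) u.1 *: 'X^(xi_weight u.2).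
(* The identity for every rational t is one of polynomials in t, so coefficients of t^k can be
   compared. *)
have P12 : P1 = P2.
  apply: poly_eq_nat => n; rewrite !horner_sum.
  under eq_bigr do rewrite hornerXn.
  under [RHS]eq_bigr do rewrite hornerZ hornerXn.
  exact: sink_generating_function.
transitivity P1`_k.
  rewrite num_acyclic_sinksE -sum1_card natr_sum coef_sum big_mkcond [RHS]big_mkcond.
  apply: eq_bigr => o _; rewrite inE coefXn eq_sym.
  by case: (o \in _) => //=; case: eqP.
rewrite P12 coef_sum /xi_coef_sum [RHS]big_mkcond; apply: eq_bigr => u _.
by rewrite coefZ coefXn eq_sym; case: eqP; rewrite ?mulr1 ?mulr0.
Qed.
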